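(* For $\theta:\mathbb N\to\mathcal P(\mathcal P(\mathbb N))$ define $\mathrm{lo}''_\theta:\mathcal P(\mathbb N)\to\mathcal P(\mathbb N)$ by $\mathrm{lo}''_\theta(p)=\{w\in\mathbb N : \text{there is a }(w,\theta,p)\text{-supporting sight}\}$. Then the function $\theta\mapsto\mathrm{lo}''_\theta$ represents the map $\mathrm{lo}_{(-)}:\nabla(\mathcal P(\mathcal P(\mathbb N))^{\mathbb N})\to\mathrm{Lo}$ in $\mathbf{Eff}$; that is, $\bigcap_{\theta}\bigcap_{p\subseteq\mathbb N}\big(\mathrm{lo}_\theta(p)\Leftrightarrow\mathrm{lo}''_\theta(p)\big)\neq\emptyset$, where $\theta$ ranges over all functions $\mathbb N\to\mathcal P(\mathcal P(\mathbb N))$.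
   Context: Write $e(n)$ for the (possibly undefined) value at $n$ of the $e$-th partial recursive function and $\langle\cdot,\cdot\rangle$ for a fixed recursive bijective pairing on $\mathbb N$. $\mathcal P(X)$ is the power set. For $A,B\subseteq\mathbb N$: $A\wedge B=\{\langle a,b\rangle : a\in A,b\in B\}$, $A\Rightarrow B=\{e : \text{for all }a\in A,\ e(a)\text{ is defined and }e(a)\in B\}$, $A\Leftrightarrow B=(A\Rightarrow B)\wedge(B\Rightarrow A)$. $\mathbf{Eff}$ is the effective topos, with subobject classifier $\Omega$ represented by $\mathcal P(\mathbb N)$ with equality predicate $\Leftrightarrow$; $\nabla(X)$ is the $\neg\neg$-sheaf on the set $X$ ($X$ with equality predicate $\mathbb N$ if $x=x'$ and $\emptyset$ otherwise); $\mathrm{Lo}$ is the object of internal local operators $\Omega\to\Omega$. For $\theta:\mathbb N\to\mathcal P(\mathcal P(\mathbb N))$ let $\mathrm{mo}_\theta(p)=\{\langle n,e\rangle : \exists A\in\theta(n),\ e\in(A\Rightarrow p)\}$. Internally, $\mathrm{lo}_\theta$ is the least local operator above $\mathrm{mo}_\theta$, and the map $\mathrm{lo}_{(-)}$ is represented by $\mathrm{lo}_\theta(p)=\bigcap_{q\subseteq\mathbb N}\big(((\mathrm{mo}_\theta(q)\Rightarrow q)\wedge(p\Rightarrow q))\Rightarrow q\big)$. A sight is, inductively, either an object called $\mathrm{Nil}$, or a pair $(A,\sigma)$ where $A\subseteq\mathbb N$ and $\sigma$ assigns to each $a\in A$ a sight $\sigma(a)$. A finite sequence $(x_1,\ldots,x_n)$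 in $\mathbb N$ is a node of $S$ if $n=0$, or $n>0$, $S=(A,\sigma)$, $x_1\in A$ and $(x_2,\ldots,x_n)$ is a node of $\sigma(x_1)$. The subsight of $S$ at a node $(x_1,\ldots,x_n)$ is $S$ if $n=0$, and the subsight of $\sigma(x_1)$ at $(x_2,\ldots,x_n)$ if $n>0$. A node is a leaf if the subsight at it is $\mathrm{Nil}$. For a node $s$, $\mathrm{Out}_S(s)$ is the set of $x\in\mathbb N$ such that $s$ extended by $x$ at the end is a node of $S$. For a partial function $w:\mathbb N^*\rightharpoonup\mathbb N$ on finite sequences, $\theta:\mathbb N\to\mathcal P(\mathcal P(\mathbb N))$ and $p\subseteq\mathbb N$, a sight $S$ is $(w,\theta,p)$-supporting if for each leaf $s$ of $S$ we have $w(s)=\langle0,y\rangle$ with $y\in p$, and for each non-leaf node $s$ of $S$ we have $w(s)=\langle1,n\rangle$ with $\mathrm{Out}_S(s)\in\theta(n)$. A number $w\in\mathbb N$ is regarded as the partial recursive function $\mathbb N^*\rightharpoonup\mathbb N$ with index $w$, via a standard recursive coding of finite sequences. *)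

(* Defs.v *)
From Stdlib Require Cantor.
From mathcomp Require Import all_boot.
From mathcomp Require Import boolp classical_sets.

Set Implicit Arguments.
Unset Strict Implicit.
Unset Printing Implicit Defensive.

Local Open Scope classical_set_scope.

(* The recursive bijection nat * nat -> nat is Cantor's. *)
Definition pairn (a b : nat) : nat := Cantor.to_nat (a, b).

(* Partial functions T -> nat are given by their graphs: [f t y] reads "f(t) is
   defined and equal to y". *)
Definition pfun (T : Type) := T -> nat -> Prop.

Definition functional (T : Type) (f : pfun T) :=
  forall t y z, f t y -> f t z -> y = z.

(* The partial recursive functions of one argument: several arguments are
   passed through [pairn], so its two projections replace the projections of
   Kleene's schemes.
     (Prec f g)(<a, 0>)     = f(a)
     (Prec f g)(<a, k + 1>) = g(<a, <k, (Prec f g)(<a, k>)>>)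
     (Mu f)(a)              = the least k with f(<a, k>) = 0, f(<a, i>) being
                              defined (and nonzero) for all i < k.  *)
Inductive code : Type :=
| Zero
| Succ
| Fst
| Snd
| Pair of code & code
| Comp of code & code
| Prec of code & code
| Mu of code.

Fixpoint prec (f g : pfun nat) (a k : nat) : nat -> Prop :=
  match k with
  | 0 => f a
  | k'.+1 => fun y => exists2 v, prec f g a k' v & g (pairn a (pairn k' v)) y
  end.

Fixpoint eval (c : code) : pfun nat :=
  match c with
  | Zero => fun _ y => y = 0
  | Succ => fun x y => y = x.+1
  | Fst => fun x y => y = (Cantor.of_nat x).1
  | Snd => fun x y => y = (Cantor.of_nat x).2
  | Pair f g => fun x y => exists u v, [/\ eval f x u, eval g x v & y = pairn u v]
  | Comp f g => fun x y => exists2 u, eval g x u & eval f u y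
  | Prec f g => fun x y =>
      prec (eval f) (eval g) (Cantor.of_nat x).1 (Cantor.of_nat x).2 y
  | Mu f => fun x y =>
      eval f (pairn x y) 0 /\
      forall i, i < y -> exists v, eval f (pairn x i) v.+1
  end.

Fixpoint index (c : code) : nat :=
  match c with
  | Zero => pairn 0 0
  | Succ => pairn 1 0
  | Fst => pairn 2 0
  | Snd => pairn 3 0
  | Pair f g => pairn 4 (pairn (index f) (index g))
  | Comp f g => pairn 5 (pairn (index f) (index g))
  | Prec f g => pairn 6 (pairn (index f) (index g))
  | Mu f => pairn 7 (index f)
  end.

(* [phi e n y] reads "e(n) is defined and equal to y".  A number that is not
   the index of a code is an index of the nowhere defined function. *)
Definition phi (e : nat) : pfun nat :=
  fun n y => exists2 c, index c = e & eval c n y.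

Lemma pairn_inj a b c d : pairn a b = pairn c d -> a = c /\ b = d.
Proof.
move=> /(congr1 Cantor.of_nat); rewrite /pairn !Cantor.cancel_of_to.
by case=> -> ->.
Qed.

Lemma index_inj : injective index.
Proof.
elim=> [||||f IHf g IHg|f IHf g IHg|f IHf g IHg|f IHf];
  case=> [||||f' g'|f' g'|f' g'|f'] //= /pairn_inj[] // _.
- by move=> /pairn_inj[/IHf -> /IHg ->].
- by move=> /pairn_inj[/IHf -> /IHg ->].
- by move=> /pairn_inj[/IHf -> /IHg ->].
- by move=> /IHf ->.
Qed.

Lemma eval_functional c : functional (eval c).
Proof.
elim: c => [||||f IHf g IHg|f IHf g IHg|f IHf g IHg|f IHf] x y z /=;
  try by move=> -> ->.
- move=> [u [v [fu gv ->]]] [u' [v' [fu' gv' ->]]].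
  by rewrite (IHf _ _ _ fu fu') (IHg _ _ _ gv gv').
- by move=> [u gu fu] [v gv]; rewrite -(IHg _ _ _ gu gv); exact: IHf.
- move: (_.1) (_.2) => a k; elim: k y z => [|k IHk] y z /=; first exact: IHf.
  by move=> [u pu gu] [v pv]; rewrite -(IHk _ _ pu pv); exact: IHg.
- move=> [fy miny] [fz minz]; case: (ltngtP y z) => // [yz|zy].
  + by have [v fv] := minz _ yz; have := IHf _ _ _ fy fv.
  + by have [v fv] := miny _ zy; have := IHf _ _ _ fz fv.
Qed.

Lemma phi_functional e : functional (phi e).
Proof.
by move=> n y z [c <- cy] [d /index_inj -> dz]; exact: eval_functional cy dz.
Qed.

Fixpoint seq_code (s : seq nat) : nat :=
  if s is x :: s' then (pairn x (seq_code s')).+1 else 0.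

(* The partial recursive function nat^* -> nat with index w. *)
Definition phi_seq (w : nat) : pfun (seq nat) := fun s => phi w (seq_code s).

Definition conj_real (A B : set nat) : set nat :=
  [set m | exists a b, [/\ m = pairn a b, A a & B b]].

Definition imp_real (A B : set nat) : set nat :=
  [set e | forall a, A a -> exists2 b, phi e a b & B b].

Definition iff_real (A B : set nat) : set nat :=
  conj_real (imp_real A B) (imp_real B A).

Definition mo (theta : nat -> set (set nat)) (p : set nat) : set nat :=
  [set m | exists n e,
     m = pairn n e /\ exists2 A, theta n A & imp_real A p e].

Definition lo (theta : nat -> set (set nat)) (p : set nat) : set nat :=
  \bigcap_(q : set nat)
    imp_real (conj_real (imp_real (mo theta q) q) (imp_real p q)) q.

(* [A -> sight] is the type of functions on the subtype {a : nat | a \in A}. *)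
Inductive sight : Type :=
| Nil
| Sight (A : set nat) (sigma : A -> sight).

Fixpoint is_node (S : sight) (s : seq nat) : Prop :=
  match s, S with
  | [::], _ => True
  | _ :: _, Nil => False
  | x :: s', Sight A sigma => exists2 a : A, val a = x & is_node (sigma a) s'
  end.

(* [is_subsight S s T]: s is a node of S, and T is the subsight of S at s. *)
Fixpoint is_subsight (S : sight) (s : seq nat) (T : sight) : Prop :=
  match s, S with
  | [::], _ => T = S
  | _ :: _, Nil => False
  | x :: s', Sight A sigma =>
      exists2 a : A, val a = x & is_subsight (sigma a) s' T
  end.

Definition is_leaf (S : sight) (s : seq nat) : Prop :=
  is_node S s /\ is_subsight S s Nil.

Definition Out (S : sight) (s : seq nat) : set nat :=
  [set x | is_node S (rcons s x)].

Definition supporting (w : pfun (seq nat)) (theta : nat -> set (set nat))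
    (p : set nat) (S : sight) : Prop :=
  (forall s, is_leaf S s -> exists2 y, w s (pairn 0 y) & p y) /\
  (forall s, is_node S s -> ~ is_leaf S s ->
     exists2 n, w s (pairn 1 n) & theta n (Out S s)).

Definition lo'' (theta : nat -> set (set nat)) (p : set nat) : set nat :=
  [set w | exists S, supporting (phi_seq w) theta p S].

(* Main.v *)
(** Kleene's theory in its minimal form suffices.  Every partial recursive
    function is evaluated by a stack machine whose step function is primitive
    recursive; searching for its halting time gives a universal function, and
    with the s-m-n theorem also the recursion theorem.

    From [lo] to [lo'']: instantiate [q := lo'' theta p] in the definition of
    [lo].  A realizer of [p => q] sends [y] to the constant function with value
    [<0, y>], supported by [Nil].  A realizer of [mo theta q => q] sends
    [<n, e>] to the function [w] with [w([::]) = <1, n>] and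
    [w(a :: s) = e(a)(s)]; if [e] maps [A] into [q], choosing supporting sights
    for all [e(a)] gives one for [w].

    From [lo''] to [lo]: given realizers [f] of [mo theta q => q] and [g] of
    [p => q], bar recursion on [w] reaches [q]: [h(w) = g(y)] if
    [w([::]) = <0, y>], and [h(w) = f(<n, a |-> h(w(a :: -))>)] if
    [w([::]) = <1, n>].  The recursion theorem provides [h], and induction on
    the supporting sight shows that it terminates with a value in [q]. *)

Require Import Defs.
From Stdlib Require Cantor.
From mathcomp Require Import all_boot.
From mathcomp Require Import boolp classical_sets.

Set Implicit Arguments.
Unset Strict Implicit.
Unset Printing Implicit Defensive.

Local Open Scope classical_set_scope.

Local Notation index := Defs.index.

(** * Projections of the pairing *)

Definition pfst (x : nat) : nat := (Cantor.of_nat x).1.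
Definition psnd (x : nat) : nat := (Cantor.of_nat x).2.

Arguments pairn : simpl never.
Arguments pfst : simpl never.
Arguments psnd : simpl never.

Lemma pfstK a b : pfst (pairn a b) = a.
Proof. by rewrite /pfst /pairn Cantor.cancel_of_to. Qed.

Lemma psndK a b : psnd (pairn a b) = b.
Proof. by rewrite /psnd /pairn Cantor.cancel_of_to. Qed.

Lemma pairn_eta x : pairn (pfst x) (psnd x) = x.
Proof. by rewrite /pairn /pfst /psnd -surjective_pairing Cantor.cancel_to_of. Qed.

Definition projE := (pfstK, psndK).

(** * Computable total functions *)

Definition computable (f : nat -> nat) := exists c, forall x, eval c x (f x).

Lemma eval_id x : eval (Pair Fst Snd) x x.
Proof. by exists (pfst x), (psnd x); split => //; rewrite pairn_eta. Qed.

Lemma computable_id : computable (fun x => x).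
Proof. by exists (Pair Fst Snd) => x; exact: eval_id. Qed.

Lemma computable_comp f g :
  computable f -> computable g -> computable (fun x => f (g x)).
Proof. by move=> [c cf] [d dg]; exists (Comp c d) => x /=; exists (g x). Qed.

Lemma computable_pair f g :
  computable f -> computable g -> computable (fun x => pairn (f x) (g x)).
Proof.
by move=> [c cf] [d dg]; exists (Pair c d) => x /=; exists (f x), (g x).
Qed.

Lemma computable_fst f : computable f -> computable (fun x => pfst (f x)).
Proof. by apply: computable_comp; exists Fst. Qed.

Lemma computable_snd f : computable f -> computable (fun x => psnd (f x)).
Proof. by apply: computable_comp; exists Snd. Qed.

Lemma computable_succ f : computable f -> computable (fun x => (f x).+1).
Proof. by apply: (@computable_comp S); exists Succ. Qed.

Fixpoint num (n : nat) : code := if n is m.+1 then Comp Succ (num m) else Zero.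

Lemma eval_num n x : eval (num n) x n.
Proof. by elim: n => //= n IHn; exists n. Qed.

Lemma computable_const n : computable (fun=> n).
Proof. by exists (num n) => x; exact: eval_num. Qed.

Lemma computable_prec f g :
  computable f -> computable g ->
  computable (fun z =>
    nat_rect (fun=> nat) (f (pfst z))
      (fun k v => g (pairn (pfst z) (pairn k v))) (psnd z)).
Proof.
move=> [c cf] [d dg]; exists (Prec c d) => z /=.
rewrite -/(pfst z) -/(psnd z); elim: (psnd z) => [|k IHk] /=; first exact: cf.
by eexists; [exact: IHk | exact: dg].
Qed.

Lemma computable_iter f a n :
  computable f -> computable a -> computable n ->
  computable (fun x => iter (n x) f (a x)).
Proof.
move=> cf ca cn.
have cg : computable (fun z => f (psnd (psnd z))).
  by apply: computable_comp => //; do 2 apply: computable_snd; exact: computable_id.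
have := computable_comp (computable_prec computable_id cg) (computable_pair ca cn).
move=> [c cP]; exists c => x; have := cP x; rewrite !projE.
by congr eval; elim: (n x) => //= m ->; rewrite !projE.
Qed.

Lemma computable_pred f : computable f -> computable (fun x => (f x).-1).
Proof.
apply: (@computable_comp predn).
have ck : computable (fun z => pfst (psnd z)).
  by apply: computable_fst; apply: computable_snd; exact: computable_id.
have [c cP] := computable_comp (computable_prec computable_id ck)
  (computable_pair (computable_const 0) computable_id).
by exists c => x; have := cP x; rewrite !projE; case: x => //= x; rewrite !projE.
Qed.

Lemma computable_if t a b :
  computable t -> computable a -> computable b ->
  computable (fun x => if t x == 0 then a x else b x).
Proof.
move=> ct ca cb.
have cbf : computable (fun z => b (pfst z)).
  by apply: computable_comp => //; apply: computable_fst; exact: computable_id.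
have [c cP] := computable_comp (computable_prec ca cbf)
  (computable_pair computable_id ct).
exists c => x; have := cP x; rewrite !projE.
by case: (t x) => //= k; rewrite !projE.
Qed.

(** Case tables are lists read at a tag. Expressing computability of a list through its access
    function lets such tables be checked entry by entry. *)
Definition computable_seq (l : nat -> seq nat) :=
  forall t, computable t -> computable (fun x => nth 0 (l x) (t x)).

Lemma computable_nil : computable_seq (fun=> [::]).
Proof.
move=> t _; have [c cP] := computable_const 0.
by exists c => x; rewrite nth_nil.
Qed.

Lemma computable_cons a l :
  computable a -> computable_seq l -> computable_seq (fun x => a x :: l x).
Proof.
move=> ca cl t ct.
have [c cP] := computable_if ct ca (cl _ (computable_pred ct)).
by exists c => x; have := cP x; case: (t x).
Qed.

Lemma computable_nth l t :
  computable_seq l -> computable t -> computable (fun x => nth 0 (l x) (t x)).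
Proof. by move=> cl; exact: cl. Qed.

Ltac computable :=
  repeat first
    [ assumption
    | exact: computable_id
    | exact: computable_const
    | apply: computable_pair
    | apply: computable_fst
    | apply: computable_snd
    | apply: computable_succ
    | apply: computable_pred
    | apply: computable_nil
    | apply: computable_cons
    | apply: computable_nth
    | apply: computable_if ].

(** * A universal function *)

(* States of the machine: [ev e x k] is about to apply the code with index [e]
   to [x], and [ret v k] returns [v], in both cases to the stack [k].  Since
   [0 = pairn (pairn 0 0) 0], the empty stack [0] is a frame with tag 0. *)
Definition ev (e x k : nat) : nat := pairn 1 (pairn (pairn e x) k).
Definition ret (v k : nat) : nat := pairn 0 (pairn v k).
Definition frame (t d k : nat) : nat := pairn (pairn t d) k.

(** Here [i] rounds of the recursion are done and [n] remain, so the loop ends on a zero test; in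
    [mu_frame], [i] is the candidate under test. *)
Definition prec_frame (g a i n k : nat) : nat :=
  frame 4 (pairn (pairn g a) (pairn i n)) k.
Definition mu_frame (f x i k : nat) : nat := frame 5 (pairn (pairn f x) i) k.

(** The entries follow the tags of [index]; any other tag gives the default state 0, which is
    halted. *)
Definition step_ev (e x k : nat) : nat :=
  let b := psnd e in
  nth 0 [:: ret 0 k; ret x.+1 k; ret (pfst x) k; ret (psnd x) k;
            ev (pfst b) x (frame 1 (pairn (psnd b) x) k);
            ev (psnd b) x (frame 3 (pfst b) k);
            ev (pfst b) (pfst x) (prec_frame (psnd b) (pfst x) 0 (psnd x) k);
            ev b (pairn x 0) (mu_frame b x 0 k)]
    (pfst e).

Definition step_ret (s v t d k : nat) : nat :=
  nth 0 [:: s;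
            ev (pfst d) (psnd d) (frame 2 v k);
            ret (pairn d v) k;
            ev d v k;
            let g := pfst (pfst d) in let a := psnd (pfst d) in
            let i := pfst (psnd d) in let n := psnd (psnd d) in
            if n == 0 then ret v k
            else ev g (pairn a (pairn i v)) (prec_frame g a i.+1 n.-1 k);
            let f := pfst (pfst d) in let x := psnd (pfst d) in
            let i := psnd d in
            if v == 0 then ret i k
            else ev f (pairn x i.+1) (mu_frame f x i.+1 k)]
    t.

Definition step (s : nat) : nat :=
  let r := psnd s in
  let k := psnd r in
  if pfst s == 0 then
    step_ret s (pfst r) (pfst (pfst k)) (psnd (pfst k)) (psnd k)
  else step_ev (pfst (pfst r)) (psnd (pfst r)) k.

(** Zero exactly when a value is returned to a frame with tag 0; being a number, it can be searched
    by [Mu]. *)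
Definition running (s : nat) : nat :=
  if pfst s == 0 then pfst (pfst (psnd (psnd s))) else 1.

Lemma computable_step : computable step.
Proof.
rewrite /step /step_ret /step_ev /prec_frame /mu_frame /frame /ev /ret.
by computable.
Qed.

Lemma computable_running : computable running.
Proof. by rewrite /running; computable. Qed.

Lemma step_halted s : running s = 0 -> step s = s.
Proof. by rewrite /running /step; case: eqP => // _ ->. Qed.

Lemma step_evE t b x k : step (ev (pairn t b) x k) = step_ev (pairn t b) x k.
Proof. by rewrite /step !projE. Qed.

Lemma step_retE v t d k :
  step (ret v (frame t d k)) = step_ret (ret v (frame t d k)) v t d k.
Proof. by rewrite /step !projE. Qed.

Definition reach (s s' : nat) := exists n, iter n step s = s'.

Lemma reach_trans s1 s2 s3 : reach s1 s2 -> reach s2 s3 -> reach s1 s3.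
Proof. by move=> [m <-] [n <-]; exists (n + m); rewrite iterD. Qed.

Lemma reach_step s : reach s (step s).
Proof. by exists 1. Qed.

(** Induction on the code; the stack [k] is arbitrary because subcomputations run with further
    frames pushed on it. *)
Lemma reach_eval c x y k : eval c x y -> reach (ev (index c) x k) (ret y k).
Proof.
elim: c x y k => [||||f IHf g IHg|f IHf g IHg|f IHf g IHg|f IHf] x y k;
  (move=> cy; apply: reach_trans; [exact: reach_step | move: cy]);
  rewrite [index _]/= step_evE /step_ev !projE [nth _ _ _]/=.
- by move=> ->; exists 0.
- by move=> ->; exists 0.
- by move=> ->; exists 0.
- by move=> ->; exists 0.
- move=> [u [v [fu gv ->]]]; apply: reach_trans; first exact: IHf fu.
  apply: reach_trans; first exact: reach_step.
  rewrite step_retE /step_ret !projE /=.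
  apply: reach_trans; first exact: IHg gv.
  by exists 1; rewrite /= step_retE.
- move=> [u gu fu]; apply: reach_trans; first exact: IHg gu.
  apply: reach_trans; first exact: reach_step.
  by rewrite step_retE; exact: IHf fu.
- rewrite /= -/(pfst x) -/(psnd x).
  set a := pfst x; set g' := index g.
  (* The total number of rounds is [j + n]: induction on the [j] completed ones trades one of them
     for a remaining one. *)
  have loop j n v : prec (eval f) (eval g) a j v ->
      reach (ev (index f) a (prec_frame g' a 0 (j + n) k))
            (ret v (prec_frame g' a j n k)).
    elim: j n v => [|j IHj] n v /=; first exact: IHf.
    move=> [u pu gv]; rewrite addSnnS; apply: reach_trans; first exact: IHj pu.
    apply: reach_trans; first exact: reach_step.
    by rewrite step_retE /step_ret !projE /=; exact: IHg gv.
  move=> /(loop _ 0); rewrite addn0 => start; apply: reach_trans start _.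
  by exists 1; rewrite /= step_retE /step_ret !projE.
- move=> [fy fpos]; set f' := index f in IHf *.
  (* All candidates below [y] give nonzero values, so each test passes on to the next candidate. *)
  have loop i : i <= y ->
      reach (ev f' (pairn x 0) (mu_frame f' x 0 k))
            (ev f' (pairn x i) (mu_frame f' x i k)).
    elim: i => [|i IHi] iy; first by exists 0.
    apply: reach_trans; first exact: IHi (ltnW iy).
    have [v fv] := fpos _ iy; apply: reach_trans; first exact: IHf fv.
    by exists 1; rewrite /= step_retE /step_ret !projE.
  apply: reach_trans; first exact: loop (leqnn y).
  apply: reach_trans; first exact: IHf fy.
  by exists 1; rewrite /= step_retE /step_ret !projE.
Qed.

Theorem universal_code :
  exists U, forall e x y, phi e x y -> eval U (pairn e x) y.
Proof.
pose run s t := iter t step (ev (pfst s) (psnd s) 0).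
have crun : computable (fun z => run (pfst z) (psnd z)).
  by apply: (computable_iter computable_step); rewrite /ev; computable.
have [ct ctP] := computable_comp computable_running crun.
have [cr crP] : computable (fun z => pfst (psnd (run (pfst z) (psnd z)))).
  by computable.
exists (Comp cr (Pair (Pair Fst Snd) (Mu ct))) => _ x y [c <- cy].
have [n nP] := reach_eval 0 cy.
set s := pairn (index c) x.
have runn : run s n = ret y 0 by rewrite /run /s !projE.
have halt : exists t, running (run s t) == 0.
  by exists n; rewrite runn /running /ret !projE.
case: (ex_minnP halt) => t /eqP t0 tmin.
(* The least halting time [t] may precede [n], but halted states are fixed by [step], so both times
   show the same result. *)
have -> : y = pfst (psnd (run s t)).
  have tn : t <= n by apply: tmin; rewrite runn /running /ret !projE.
  have stay m : iter m step (run s t) = run s t.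
    by elim: m => //= m ->; exact: step_halted.
  by rewrite -(stay (n - t)) /run -iterD subnK // -/(run s n) runn /ret !projE.
exists (pairn s t); last by have := crP (pairn s t); rewrite !projE.
exists s, t; split=> //; first exact: eval_id.
split; first by have := ctP (pairn s t); rewrite !projE t0.
move=> i it; have := ctP (pairn s i); rewrite !projE.
case E: (running _) => [|v]; last by exists v.
by have := tmin i; rewrite E leqNgt it => /(_ isT).
Qed.

(** * Partial computable functions, s-m-n and recursion theorems *)

(* Some partial recursive function extends [F]: realizers are only ever
   applied where they are defined. *)
Definition pcomputable (F : pfun nat) :=
  exists e, forall x y, F x y -> phi e x y.

Lemma pcomputable_total f : computable f -> pcomputable (fun x y => y = f x).
Proof.
by move=> [c cP]; exists (index c) => x _ ->; exists c => //; exact: cP.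
Qed.

Lemma pcomputable_phi e t :
  computable e -> computable t -> pcomputable (fun x => phi (e x) (t x)).
Proof.
move=> ce ct; have [U UP] := universal_code.
have [c cP] := computable_pair ce ct.
exists (index (Comp U c)) => x y /UP Uy.
by exists (Comp U c) => //; exists (pairn (e x) (t x)).
Qed.

Lemma pcomputable_subst F t :
  pcomputable F -> computable t -> pcomputable (fun x => F (t x)).
Proof.
move=> [e eP] ct; have [d dP] := pcomputable_phi (computable_const e) ct.
by exists d => x y /eP /dP.
Qed.

Lemma pcomputable_bind F G :
  pcomputable F -> pcomputable G ->
  pcomputable (fun x y => exists2 u, F x u & G (pairn x u) y).
Proof.
move=> [e eP] [d dP]; have [U UP] := universal_code.
(* The numbers [e] and [d] need not be indices of codes, so codes are obtained from them through
   [U]. *)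
pose c z := Comp U (Pair (num z) (Pair Fst Snd)).
have cP z x y : phi z x y -> eval (c z) x y.
  move=> /UP Uy; exists (pairn z x) => //.
  by exists z, x; split=> //; [exact: eval_num | exact: eval_id].
pose b := Comp (c d) (Pair (Pair Fst Snd) (c e)).
exists (index b) => x y [u /eP/cP eu /dP/cP dy]; exists b => //.
by exists (pairn x u) => //; exists x, u; split=> //; exact: eval_id.
Qed.

Theorem smn F : pcomputable F ->
  exists2 s, computable s & forall a x y, F (pairn a x) y -> phi (s a) x y.
Proof.
move=> [e eP]; have [U UP] := universal_code.
pose curry a := Comp U (Pair (num e) (Pair (num a) (Pair Fst Snd))).
exists (fun a => index (curry a)); last first.
  move=> a x y /eP/UP Uy; exists (curry a) => //.
  exists (pairn e (pairn a x)) => //; exists e, (pairn a x).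
  split=> //; first exact: eval_num.
  by exists a, x; split=> //; [exact: eval_num | exact: eval_id].
have cnum : computable (fun a => index (num a)).
  (* Passing from [num a] to [num a.+1] acts on indices as this map, so [index (num a)] is an
     iterate. *)
  have cs : computable (fun i => pairn 5 (pairn (index Succ) i)).
    by computable.
  have [c cP] := computable_iter cs (computable_const (index Zero)) computable_id.
  exists c => a; have := cP a; congr eval.
  by elim: a => // a IHa; rewrite iterS IHa.
by rewrite /curry; lazy beta delta [index] iota; computable.
Qed.

(** Kleene's diagonal argument: [s d] computes [d(<d, x>)]. If [g] computes [F(<s(d), x>)] from
    [<d, x>], then [h = s g] is as wanted. *)
Theorem recursion F : pcomputable F ->
  exists h, forall x y, F (pairn h x) y -> phi h x y.
Proof.
move=> cF.
have [s cs sP] : exists2 s, computable s &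
    forall d x y, phi d (pairn d x) y -> phi (s d) x y.
  have [s cs sP] : exists2 s, computable s &
      forall a x y, phi (pfst (pairn a x)) (pairn a x) y -> phi (s a) x y.
    by apply: (@smn (fun z => phi (pfst z) z)); apply: pcomputable_phi; computable.
  by exists s => // d x y; have := sP d x y; rewrite !projE.
have [g gP] : pcomputable (fun z => F (pairn (s (pfst z)) (psnd z))).
  apply: pcomputable_subst => //; computable.
  by apply: computable_comp => //; computable.
by exists (s g) => x y Fy; apply/sP/gP; rewrite !projE.
Qed.

(** * The two realizers *)


(** The index is chosen before [A] and [B]; this gives realizers uniform in [theta] and [p]. *)
Lemma imp_real_pcomputable F : pcomputable F ->
  exists e, forall A B : set nat,
    (forall a, A a -> exists2 b, F a b & B b) -> imp_real A B e.
Proof.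
move=> [e eP]; exists e => A B FAB a /FAB[b Fab Bb].
by exists b => //; exact: eP.
Qed.

(** * Supporting sights *)

Lemma supporting_Nil w theta p y :
  w [::] (pairn 0 y) -> p y -> supporting w theta p Defs.Nil.
Proof.
move=> wy py; split=> [[|x s] [] //= _ _|[|x s] //= _ []]; last by [].
by exists y.
Qed.

Lemma is_node_nil S : is_node S [::].
Proof. by case: S. Qed.

Lemma Out_Sight_nil (A : set nat) (sigma : A -> sight) :
  Out (Sight sigma) [::] = A.
Proof.
apply/seteqP; split=> x /= => [[a <- _]|/mem_set Ax]; first exact: set_valP.
by exists (exist _ x Ax) => //; exact: is_node_nil.
Qed.

Lemma Out_Sight_cons (A : set nat) (sigma : A -> sight) a s :
  Out (Sight sigma) (val a :: s) = Out (sigma a) s.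
Proof.
by apply/seteqP; split=> x /= => [[b /val_inj ->]|nod] //; exists a.
Qed.

Lemma is_leaf_Sight_cons (A : set nat) (sigma : A -> sight) a s :
  is_leaf (Sight sigma) (val a :: s) <-> is_leaf (sigma a) s.
Proof.
split=> [[[b /val_inj -> nod] [c /val_inj -> sub]]|[nod sub]] //.
by split; exists a.
Qed.

(** A node is empty or starts with some element of [A], so support splits into a root condition and
    support of the subsights by the shifted [w]. *)
Lemma supporting_Sight (w : pfun (seq nat)) theta p (A : set nat) sigma :
  supporting w theta p (@Sight A sigma) <->
  (exists2 n, w [::] (pairn 1 n) & theta n A) /\
  (forall a : A, supporting (fun s => w (val a :: s)) theta p (sigma a)).
Proof.
split=> [[leafP nodeP]|[[n wn thA] sup]]; split.
- by have [|n wn] := nodeP [::] I; [case | rewrite Out_Sight_nil; exists n].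
- move=> a; split=> [s leaf|s nod leaf].
    by apply: leafP; apply/is_leaf_Sight_cons.
  have [||n wn] := nodeP (val a :: s); first by exists a.
    by rewrite is_leaf_Sight_cons.
  by rewrite Out_Sight_cons; exists n.
- move=> [|x s]; first by case.
  move=> leaf; have [a ax _] := leaf.1; move: leaf.
  by rewrite -ax is_leaf_Sight_cons; exact: (sup a).1.
- move=> [|x s] /= => [_ _|[a <- nod]]; first by exists n; rewrite ?Out_Sight_nil.
  by rewrite is_leaf_Sight_cons Out_Sight_cons; exact: (sup a).2.
Qed.

Lemma supporting_sub (w w' : pfun (seq nat)) theta p S :
  (forall s y, w s y -> w' s y) ->
  supporting w theta p S -> supporting w' theta p S.
Proof.
move=> ww' [leafP nodeP]; split=> s; first by move=> /leafP[y /ww']; exists y.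
by move=> nod /(nodeP _ nod)[n /ww']; exists n.
Qed.

Lemma lo_lo'' :
  exists u, forall theta p, imp_real (lo theta p) (lo'' theta p) u.
Proof.
have [s cs sP] : exists2 s, computable s &
    forall y x, phi (s y) x (pairn 0 y).
  have [|s cs sP] := smn (@pcomputable_total (fun z => pairn 0 (pfst z)) _).
    by computable.
  by exists s => // y x; apply: sP; rewrite projE.
have [e2 e2P] := imp_real_pcomputable (pcomputable_total cs).
have [c cP] : pcomputable (fun z y =>
    exists2 u, phi (pfst (pfst z)) (psnd (pfst z)) u & phi u (psnd z) y).
  have [||d dP] := @pcomputable_bind
    (fun z => phi (pfst (pfst z)) (psnd (pfst z)))
    (fun z => phi (psnd z) (psnd (pfst z)));
    try by apply: pcomputable_phi; computable.
  exists d => z y [u eu uy]; apply: dP; exists u => //.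
  by rewrite !projE.
(* With an index of the identity, both cases of [w] become one call of [phi] whose index and
   argument are total computable case distinctions. *)
have [i iP] := pcomputable_total computable_id.
(* On [<<n, e>, t>]; the codes [t] are [0] for [::] and [<a, t'> + 1] for
   [a :: s'], and [c] is an index of [<<e, a>, t'> |-> e(a)(t')]. *)
have [||w cw wP] := smn (@pcomputable_phi
    (fun z => if psnd z == 0 then i else c)
    (fun z => if psnd z == 0 then pairn 1 (pfst (pfst z)) else
       pairn (pairn (psnd (pfst z)) (pfst (psnd z).-1)) (psnd (psnd z).-1)) _ _);
  try by computable.
have [e1 e1P] := imp_real_pcomputable (pcomputable_total cw).
(* [u] applies a realizer of [lo theta p] to the fixed pair [<e1, e2>]. *)
have [u uP] := imp_real_pcomputable
  (pcomputable_phi computable_id (computable_const (pairn e1 e2))).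
exists u => theta p; apply: uP => m /(_ (lo'' theta p) I); apply.
exists e1, e2; split=> //.
  apply: e1P => _ [n [e [-> [A thA eA]]]]; exists (w (pairn n e)) => //.
  have /choice[sigma sigmaP] : forall a : A, exists S,
      supporting (fun s => phi_seq (w (pairn n e)) (val a :: s)) theta p S.
    move=> a; have [v eav [S supS]] := eA _ (set_valP a).
    exists S; apply: supporting_sub supS => t y vty; apply: wP; rewrite !projE /=.
    by apply: cP; exists v; rewrite !projE.
  exists (Sight sigma); apply/supporting_Sight; split=> //; exists n => //.
  by apply: wP; rewrite !projE /=; exact: iP.
apply: e2P => y py; exists (s y) => //; exists Defs.Nil.
by apply: supporting_Nil py; exact: sP.
Qed.

Lemma lo''_lo :
  exists v, forall theta p, imp_real (lo'' theta p) (lo theta p) v.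
Proof.
(* [shift] passes to the function supporting an immediate subsight. *)
have [shift cshift shiftP] : exists2 shift, computable shift &
    forall w x s y, phi_seq w (x :: s) y -> phi_seq (shift (pairn w x)) s y.
  have [||shift cshift shiftP] := smn (@pcomputable_phi (fun z => pfst (pfst z))
    (fun z => (pairn (psnd (pfst z)) (psnd z)).+1) _ _); try by computable.
  by exists shift => // w x s y wy; apply: shiftP; rewrite !projE.
(* [k <h, <w, m>>] is an index of [x |-> h(<shift(<w, x>), m>)]. *)
have [k ck kP] : exists2 k, computable k & forall h w m x y,
    phi h (pairn (shift (pairn w x)) m) y ->
    phi (k (pairn h (pairn w m))) x y.
  have [||k ck kP] := smn (@pcomputable_phi (fun z => pfst (pfst z))
    (fun z => pairn (shift (pairn (pfst (psnd (pfst z))) (psnd z)))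
                    (psnd (psnd (pfst z)))) _ _).
  - by computable.
  - by computable; apply: computable_comp => //; computable.
  - by exists k => // h w m x y hy; apply: kP; rewrite !projE.
(* Here [m] stands for [<f, g>], and [r] is the value of [w] at the root, whose code is 0. *)
have [h hP] : exists h, forall w m r y,
    phi w 0 r ->
    phi (if pfst r == 0 then psnd m else pfst m)
        (if pfst r == 0 then psnd r
         else pairn (psnd r) (k (pairn h (pairn w m)))) y ->
    phi h (pairn w m) y.
  have [||h hP] := recursion (@pcomputable_bind
    (fun z => phi (pfst (psnd z)) 0)
    (fun z => let r := psnd z in let m := psnd (psnd (pfst z)) in
       phi (if pfst r == 0 then psnd m else pfst m)
           (if pfst r == 0 then psnd r else pairn (psnd r) (k (pfst z)))) _ _).
  - by apply: pcomputable_phi; computable.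
  - apply: pcomputable_phi; computable.
    by apply: computable_comp => //; computable.
  - by exists h => w m r y wr ry; apply: hP; exists r; rewrite !projE.
have [s cs sP] := smn (@pcomputable_phi (fun=> h) (fun z => z)
  (computable_const h) computable_id).
have [v vP] := imp_real_pcomputable (pcomputable_total cs).
exists v => theta p; apply: vP => w [S supS]; exists (s w) => // q _.
move=> _ [f [g [-> fP gP]]].
suff [b hb qb] : exists2 b, phi h (pairn w (pairn f g)) b & q b.
  by exists b => //; exact: sP.
(* [w] is generalized, as the subsight at [x] is supported by [shift (pairn w x)]. *)
elim: S w supS => [|A sigma IH] w supS.
  have [|y wy py] := supS.1 [::]; first by [].
  have [b gb qb] := gP _ py; exists b => //.
  by apply: hP wy _; rewrite !projE.
have [[n wn thA] sup] := (supporting_Sight _ _ _ _).1 supS.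
have [|b fb qb] := fP (pairn n (k (pairn h (pairn w (pairn f g))))).
  exists n, (k (pairn h (pairn w (pairn f g)))); split=> //; exists A => // x Ax.
  have [|b hb qb] := IH (exist _ x (mem_set Ax)) (shift (pairn w x)).
    by apply: supporting_sub (sup _) => t y; exact: shiftP.
  by exists b => //; exact: kP.
by exists b => //; apply: hP wn _; rewrite !projE.
Qed.

Theorem proposition3p2p21 :
  \bigcap_(theta : nat -> set (set nat)) \bigcap_(p : set nat)
    iff_real (lo theta p) (lo'' theta p) !=set0.
Proof.
have [u uP] := lo_lo''; have [v vP] := lo''_lo.
by exists (pairn u v) => theta _ p _; exists u, v.
Qed.
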